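(* Let $p$ be a prime, let $G$ be a non-abelian finite $p$-group and let $M$ be a central subgroup of $G$. Then $\operatorname{Aut}_{Z(G)}^{M}(G) = \operatorname{Inn}(G)$ if and only if the nilpotency class of $G$ is $2$, $\gamma_2(G) \le M$ and $M$ is cyclic.
   Context: $Z(G)$ denotes the center of $G$, $\gamma_2(G)$ the commutator subgroup, $\operatorname{Aut}(G)$ the automorphism group, and $\operatorname{Inn}(G)$ the group of inner automorphisms. For a central subgroup $M$ of $G$ (i.e. $M \le Z(G)$), $\operatorname{Aut}_{Z(G)}^{M}(G)$ is the subgroup of $\operatorname{Aut}(G)$ consisting of all automorphisms $\alpha$ that induce the identity on $G/M$ (i.e. $x^{-1}\alpha(x) \in M$ for all $x \in G$) and fix $Z(G)$ element-wise. *)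

(* Defs.v *)
From mathcomp Require Import all_boot all_fingroup all_solvable.

Set Implicit Arguments.
Unset Strict Implicit.
Unset Printing Implicit Defensive.

Local Open Scope group_scope.

Section AutomorphismSubgroups.

Variable gT : finGroupType.

(* [conj_aut G g] is the automorphism x |-> x ^ g of G, extended by the
   identity outside G so as to be an element of [Aut G]. *)
Definition Inn (G : {group gT}) : {set {perm gT}} := conj_aut G @* G.

Definition AutZM (G M : {group gT}) : {set {perm gT}} :=
  [set a in Aut G | [forall x in G, x^-1 * a x \in M]
                  & [forall z in 'Z(G), a z == z]].

Lemma AutZM_group_set (G M : {group gT}) : group_set (AutZM G M).
Proof.
apply/group_setP; split=> [|a b].
  rewrite inE group1 /=; apply/andP; split; apply/forall_inP=> x _.
    by rewrite perm1 mulVg group1.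
  by rewrite perm1.
rewrite inE => /and3P[Aa /forall_inP aM /forall_inP aZ].
rewrite inE => /and3P[Ab /forall_inP bM /forall_inP bZ].
rewrite inE groupM //=; apply/andP; split; apply/forall_inP=> x xG.
  have axG : a x \in G by rewrite (Aut_closed Aa).
  by rewrite permM -(mulKVg (a x) (b _)) mulgA groupM ?aM ?bM.
by rewrite permM (eqP (aZ _ xG)) bZ.
Qed.

Canonical AutZM_group (G M : {group gT}) := Group (AutZM_group_set G M).
Canonical Inn_group (G : {group gT}) := [group of Inn G].

End AutomorphismSubgroups.

(* Main.v *)
Require Import Defs.
From mathcomp Require Import all_boot all_fingroup all_solvable.
From mathcomp Require Import ssralg poly zmodp matrix algC.
From mathcomp Require Import mxrepresentation classfun character.

Local Open Scope group_scope.

(** Why the theorem holds.  Write Z for the center of G.  Since M is central,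
    a |-> (x |-> x^-1 * a x) identifies the automorphisms in AutZM G M with
    the homomorphisms from G / Z to M ([AutZM_mul_div], [AutZM_of_hom]).
    Suppose that G / Z is abelian and that C is a cyclic central subgroup whose
    order is a multiple of the exponent of G / Z.  Then Hom(G / Z, C) is the
    dual group of G / Z, because the values of a faithful character of C include
    every root of unity that a character of G / Z can take, and so it has
    exactly #|G / Z| = #|Inn G| elements ([card_AutZM_cyclic]).  This count is
    the heart of both implications.

    If G has class 2, then x^n commutes with y as soon as [~ x, y]^n = 1, so the
    exponent of G / Z divides the exponent of any subgroup containing G^`(1)
    ([exponent_quotient_center_dvd]).  When G^`(1) is contained in M, all
    inner automorphisms lie in AutZM G M; when M is moreover cyclic, the count
    turns this inclusion into an equality.

    Conversely, AutZM G M = Inn G says at once that the commutators lie in M,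
    hence in Z, so the class is 2.  As M is an abelian p-group, it contains
    a cyclic subgroup C of order exponent M, and the count gives
    #|AutZM G C| = #|Inn G| = #|AutZM G M|: every homomorphism from G / Z to M
    takes its values in C.  But every element u of order p in M is a value of
    some such homomorphism, which factors through a quotient of order p of
    G / Z ([AutZM_reaches_order_p]).  So the p-torsion of M lies in the cyclic
    group C, which forces M to be cyclic. *)

(** * Automorphisms trivial modulo M as homomorphisms into M *)

Section CentralAutomorphisms.

Variables (gT : finGroupType) (G M : {group gT}).
Hypothesis MZ : M \subset 'Z(G).

Lemma AutZMP a :
  reflect [/\ a \in Aut G, {in G, forall x, x^-1 * a x \in M}
            & {in 'Z(G), forall z, a z = z}]
          (a \in AutZM G M).
Proof.
rewrite [a \in AutZM G M]inE.
apply: (iffP and3P) => [[Aa /forall_inP aM /forall_inP aZ]|].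
  by split=> // z /aZ/eqP.
by case=> Aa aM aZ; split=> //; apply/forall_inP => // z /aZ ->.
Qed.

Lemma AutZM_mul_div a : a \in AutZM G M ->
  {in G &, {morph (fun x => x^-1 * a x) : x y / x * y}}.
Proof.
case/AutZMP=> Aa aM _ x y xG yG /=.
have /centerP[_ cx] := subsetP MZ _ (aM x xG).
have -> : a (x * y) = a x * a y by rewrite -!(autmE Aa) morphM.
by rewrite [RHS]mulgA (cx _ (groupVr yG)) invMg !mulgA.
Qed.

(** The automorphism is x |-> x * f x: if x * f x = 1, then x lies in M, hence
    in the center, where f is 1; so the map is injective on the finite group
    G. *)
Lemma AutZM_of_hom (f : gT -> gT) :
    {in G &, {morph f : x y / x * y}} -> {in G, forall x, f x \in M} ->
    {in 'Z(G), forall z, f z = 1} ->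
  exists2 a, a \in AutZM G M & {in G, forall x, x^-1 * a x = f x}.
Proof.
move=> fM fG fZ.
have sMG : M \subset G := subset_trans MZ (center_sub G).
have phiM : {in G &, {morph (fun x => x * f x) : x y / x * y}}.
  move=> x y xG yG /=; rewrite fM //.
  have /centerP[_ cx] := subsetP MZ _ (fG x xG).
  by rewrite -!mulgA; congr (_ * _); rewrite !mulgA (cx y yG).
pose phi := Morphism phiM.
have inj_phi : 'injm phi.
  apply/subsetP=> x /morphpreP[xG /set1P]; rewrite /= => xfx1.
  have xM : x \in M.
    rewrite -groupV (_ : x^-1 = f x) ?fG //.
    by apply/eqP; rewrite eq_invg_mul xfx1.
  by rewrite inE; move: xfx1; rewrite (fZ x (subsetP MZ x xM)) mulg1 => ->.
have im_phi : phi @* G = G.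
  apply/eqP; rewrite eqEcard card_injm // leqnn andbT.
  apply/subsetP=> _ /morphimP[x _ xG ->] /=.
  by rewrite groupM // (subsetP sMG) ?fG.
have aE x : x \in G -> aut inj_phi im_phi x = x * f x.
  by move=> xG; rewrite autE.
exists (aut inj_phi im_phi) => [|x xG]; last by rewrite aE ?mulKg.
apply/AutZMP; split=> [|x xG|z zZ]; first exact: Aut_aut.
  by rewrite aE // mulKg fG.
by rewrite aE ?(subsetP (center_sub G)) // fZ // mulg1.
Qed.

Lemma eq_AutZM a b : a \in AutZM G M -> b \in AutZM G M ->
  {in G, forall x, x^-1 * a x = x^-1 * b x} -> a = b.
Proof.
move=> /AutZMP[Aa _ _] /AutZMP[Ab _ _] eq_ab.
by apply: (eq_Aut Aa Ab) => x xG; apply: (mulgI x^-1); apply: eq_ab.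
Qed.

End CentralAutomorphisms.

Lemma AutZMS (gT : finGroupType) (G M N : {group gT}) :
  M \subset N -> AutZM G M \subset AutZM G N.
Proof.
move=> sMN; apply/subsetP=> a /AutZMP[Aa aM aZ].
by apply/AutZMP; split=> // x xG; rewrite (subsetP sMN) ?aM.
Qed.

(** * Counting homomorphisms into a cyclic group with characters *)

Lemma ex_lin_Iirr (gT : finGroupType) (G : {group gT}) (h : gT -> algC) :
    h 1 = 1%R -> {in G &, forall x y, h (x * y) = (h x * h y)%R} ->
  exists2 i : Iirr G, ('chi_i)%R \is a linear_char & {in G, ('chi_i)%R =1 h}.
Proof.
move=> h1 hM.
have rP : mx_repr G (fun x => (h x)%:M%R : 'M[algC]_1).
  by split=> [|x y xG yG]; rewrite ?h1 // hM // scalar_mxM.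
pose rG := MxRepresentation rP.
have lin_r : cfRepr rG \is a linear_char.
  by rewrite qualifE /= cfRepr_char cfRepr1 eqxx.
have /irrP[i def_i] := lin_char_irr lin_r.
exists i; first by rewrite -def_i.
by move=> x xG; rewrite -def_i cfunE xG /= mxtrace_scalar.
Qed.

(** A faithful linear character takes a generator of C to a root of unity whose
    order is exactly #|C|, so its image contains every #|C|-th root of unity. *)
Lemma cyclic_char_bij (gT : finGroupType) (p : nat) (C : {group gT}) :
    p.-group C -> cyclic C ->
  exists lam : 'CF(C), [/\ lam \is a linear_char, {in C &, injective lam}
    & forall z : algC, (z ^+ #|C|)%R = 1%R -> exists2 y, y \in C & lam y = z].
Proof.
move=> pC cycC; have abC := cyclic_abelian cycC.
have [|i faith_i] := pgroup_cyclic_faithful pC.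
  by rewrite (center_idP abC).
have lin_i : ('chi_i)%R \is a linear_char by apply/char_abelianP.
have ker1 y : y \in C -> ('chi_i)%R y = 1%R -> y = 1.
  move=> yC chiy; apply/set1P; apply: (subsetP faith_i).
  by rewrite cfkerEirr inE chiy lin_char1.
exists ('chi_i)%R; split=> // [x y xC yC eq_xy | z zC].
  apply/eqP; rewrite eq_mulgV1; apply/eqP/ker1; first by rewrite groupM ?groupV.
  rewrite lin_charM ?groupV // lin_charV // eq_xy.
  by rewrite GRing.divff // lin_char_neq0.
have [c defC] := cyclicP cycC; have cC : c \in C by rewrite defC cycle_id.
have [m prim_m m_dv] :=
  prim_order_exists (order_gt0 c) (lin_char_unity_root lin_i cC).
have def_m : m = #|C|.
  apply/eqP; rewrite defC eqn_dvd m_dv order_dvdn; apply/eqP/ker1.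
    exact: groupX.
  by rewrite lin_charX // prim_expr_order.
have [|k def_z] := prim_rootP prim_m (x := z); first by rewrite def_m.
by exists (c ^+ k); rewrite ?groupX // lin_charX.
Qed.

(** Composition with a faithful character of C turns Hom(G / Z(G), C) into the
    set of all linear characters of G / Z(G); the condition on the exponent
    makes their values lie in the image of C. *)
Lemma card_AutZM_cyclic (gT : finGroupType) (p : nat) (G C : {group gT}) :
    p.-group C -> cyclic C -> C \subset 'Z(G) -> abelian (G / 'Z(G)) ->
    exponent (G / 'Z(G)) %| #|C| ->
  #|AutZM G C| = #|G / 'Z(G)|.
Proof.
move=> pC cycC CZ abQ expQ.
have nZG : 'Z(G) <| G := center_normal G.
have [lam [lin_lam inj_lam surj_lam]] := cyclic_char_bij _ _ _ pC cycC.
rewrite -(card_Iirr_abelian abQ); apply/eqP; rewrite eqn_leq; apply/andP; split.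
- (* Upper bound: distinct automorphisms give distinct characters of G / Z(G),
     because lam is injective on C. *)
  have ex_chi a : exists i : Iirr (G / 'Z(G)), a \in AutZM G C ->
      {in G, forall x, ('chi_i)%R (coset 'Z(G) x) = lam (x^-1 * a x)}.
    have [aA | _] := boolP (a \in AutZM G C); last by exists 0%R.
    have /AutZMP[_ aC aZ] := aA.
    have [||i lin_i chiE] :=
        ex_lin_Iirr _ G (fun x => lam (x^-1 * a x)).
    - by rewrite aZ ?group1 // mulVg lin_char1.
    - by move=> x y xG yG; rewrite (AutZM_mul_div _ _ _ CZ a) // lin_charM ?aC.
    have kerZ : 'Z(G) \subset cfker ('chi_i)%R.
      apply/subsetP=> z zZ; have zG := subsetP (center_sub G) z zZ.
      by rewrite cfkerEirr inE !chiE // aZ // aZ ?group1 // !mulVg.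
    by exists (quo_Iirr 'Z(G) i) => _ x xG; rewrite quo_IirrE // cfQuoE // chiE.
  have [F FE] := fin_all_exists ex_chi.
  apply: (@leq_card_in _ _ F) => a b aA bA eqF.
  apply: (eq_AutZM _ _ _ _ _ aA bA) => x xG.
  have [/AutZMP[_ aC _] /AutZMP[_ bC _]] := (aA, bA).
  by apply: inj_lam; rewrite ?aC ?bC // -!FE // eqF.
(* Lower bound: each character of G / Z(G) lifts through lam to a map into C. *)
have ex_aut (i : Iirr (G / 'Z(G))) : exists a, a \in AutZM G C /\
    {in G, forall x, lam (x^-1 * a x) = ('chi_i)%R (coset 'Z(G) x)}.
  have lin_i : ('chi_i)%R \is a linear_char by apply/char_abelianP.
  have ex_f x : exists y, x \in G ->
      y \in C /\ lam y = ('chi_i)%R (coset 'Z(G) x).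
    have [xG | _] := boolP (x \in G); last by exists 1.
    have xQ : coset 'Z(G) x \in G / 'Z(G) by rewrite mem_quotient.
    have [|y yC lam_y] := surj_lam (('chi_i)%R (coset 'Z(G) x));
      last by exists y.
    rewrite -lin_charX //; have /dvdnP[k ->] := expQ.
    by rewrite mulnC expgM expg_exponent // expg1n lin_char1.
  have [f fE] := fin_all_exists ex_f.
  have fC x : x \in G -> f x \in C by case/fE.
  have lam_f x : x \in G -> lam (f x) = ('chi_i)%R (coset 'Z(G) x) by case/fE.
  have nZ x : x \in G -> x \in 'N('Z(G)) by apply: subsetP (normal_norm nZG) x.
  have [|//||a aA aE] := AutZM_of_hom _ G C CZ f.
  - move=> x y xG yG; apply: inj_lam; rewrite ?groupM ?fC ?groupM //.
    rewrite lam_f ?groupM // lin_charM ?fC // !lam_f // morphM ?nZ //.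
    by rewrite lin_charM ?mem_quotient.
  - move=> z zZ; have zG := subsetP (center_sub G) z zZ.
    apply: inj_lam; rewrite ?fC //.
    by rewrite lam_f // coset_id // !lin_char1.
  by exists a; split=> // x xG; rewrite aE // lam_f.
have [F FE] := fin_all_exists ex_aut.
have inj_F : injective F.
  move=> i j eqF; apply: irr_inj; apply/cfun_inP=> _ /morphimP[x _ xG ->].
  by have [[_ <-//] [_ <-//]] := (FE i, FE j); rewrite eqF.
rewrite -(card_codom inj_F); apply: subset_leq_card.
by apply/subsetP=> _ /codomP[i ->]; case: (FE i).
Qed.

(** * Inner automorphisms *)

Lemma card_Inn (gT : finGroupType) (G : {group gT}) :
  #|Inn G| = #|G / 'Z(G)|.
Proof.
rewrite card_morphim card_quotient ?normal_norm ?center_normal //.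
by rewrite ker_conj_aut (setIidPr (normG G)) /center indexgI.
Qed.

Lemma Inn_sub_AutZM (gT : finGroupType) (G M : {group gT}) :
  (Inn G \subset AutZM G M) = (G^`(1) \subset M).
Proof.
rewrite gen_subG; apply/subsetP/subsetP=> [InnM | derM].
  move=> _ /imset2P[x g xG gG ->].
  have : conj_aut G g \in AutZM G M.
    by rewrite InnM // mem_morphim // (subsetP (normG G)).
  by case/AutZMP=> _ /(_ x xG); rewrite conj_autE.
move=> _ /morphimP[g _ gG ->]; apply/AutZMP.
split=> [|x xG|z /centerP[zG cz]]; first exact: Aut_aut.
  by rewrite conj_autE //; apply: derM; apply: imset2_f.
by rewrite conj_autE // conjgE cz // mulKg.
Qed.

(** * Exponents and elements of order p *)

(** Commutators being central, [~ x ^+ n, y] = [~ x, y] ^+ n; for n the exponent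
    of M this is 1, so that x ^+ n is central. *)
Lemma exponent_quotient_center_dvd (gT : finGroupType) (G M : {group gT}) :
    G^`(1) \subset M -> G^`(1) \subset 'Z(G) ->
  exponent (G / 'Z(G)) %| exponent M.
Proof.
move=> derM derZ; apply/exponentP=> _ /morphimP[x nx xG ->].
rewrite -morphX //= coset_id //; apply/centerP; split=> [|y yG].
  exact: groupX.
have cxy : [~ x, y] \in G^`(1) by rewrite mem_commg.
apply/commgP; rewrite commXg.
  by rewrite expg_exponent // (subsetP derM).
by have /centerP[_ /(_ x xG) ?] := subsetP derZ _ cxy; apply: commute_sym.
Qed.

(** A maximal subgroup containing Z(G) has index p, so G / Z(G) maps onto any
    subgroup of order p. *)
Lemma AutZM_reaches_order_p (gT : finGroupType) (p : nat) (G M : {group gT}) u :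
    prime p -> p.-group G -> ~~ abelian G -> M \subset 'Z(G) ->
    u \in M -> #[u] = p ->
  exists2 a, a \in AutZM G M & exists2 x, x \in G & x^-1 * a x = u.
Proof.
move=> p_pr pG nabG MZ uM ord_u.
have [eqZG | [N maxN sZN]] := maximal_exists (center_sub G).
  by case/negP: nabG; rewrite -{1}eqZG center_abelian.
have nNG := p_maximal_normal pG maxN; have sNG := normal_norm nNG.
have cardQ : #|G / N| = p by rewrite card_quotient ?(p_maximal_index pG).
have : (G / N)%G \isog <[u]>.
  rewrite isog_cyclic_card ?(prime_cyclic (G := G / N)) ?cardQ //.
  by rewrite cycle_cyclic -[#|_|]/(#[u]) ord_u eqxx.
case/isogP=> iota inj_iota im_iota.
have sNx x : x \in G -> x \in 'N(N) by apply: subsetP.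
have [||z zZ|a aA aE] := AutZM_of_hom _ G M MZ (fun x => iota (coset N x)).
- by move=> x y xG yG; rewrite morphM ?sNx // morphM ?mem_quotient.
- move=> x xG; apply: (subsetP (_ : <[u]> \subset M)).
    by rewrite cycle_subG.
  by rewrite -im_iota mem_morphim ?mem_quotient.
- by rewrite coset_id ?morph1 // (subsetP sZN).
have : u \in iota @* (G / N) by rewrite im_iota cycle_id.
case/morphimP=> _ _ /morphimP[x _ xG ->] def_u.
by exists a => //; exists x; rewrite // aE.
Qed.

(** An abelian p-group has the same rank as the subgroup generated by its
    elements of order p, and here that subgroup lies in a group of rank at
    most 1. *)
Lemma cyclic_if_order_p_sub_cyclic (gT : finGroupType) (p : nat)
    (M C : {group gT}) :
    p.-group M -> abelian M -> cyclic C ->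
    {in M, forall u, #[u] = p -> u \in C} ->
  cyclic M.
Proof.
move=> pM abM cycC sub_p; rewrite abelian_rank1_cyclic // -rank_Ohm1.
apply: (@leq_trans 'r(C)); last first.
  by rewrite -abelian_rank1_cyclic ?cyclic_abelian.
apply: rankS; rewrite (OhmE 1 pM) gen_subG; apply/subsetP=> u.
rewrite !inE expn1 => /andP[uM].
have [-> // | ntu] := eqVneq u 1.
have pu : p.-group <[u]> := mem_p_elt pM uM.
have [|p_pr _ _] := pgroup_pdiv pu; first by rewrite cycle_eq1.
by move/eqP=> up1; apply: sub_p => //; apply: nt_prime_order.
Qed.

Theorem proposition2p3 (gT : finGroupType) (p : nat) (G M : {group gT})
    (p_pr : prime p) (pG : p.-group G) (nabG : ~~ abelian G)
    (MZ : M \subset 'Z(G)) :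
  AutZM G M = Inn G
  <-> [/\ nil_class G = 2, G^`(1) \subset M & cyclic M].
Proof.
have abM : abelian M := abelianS MZ (center_abelian G).
have pM : p.-group M.
  by rewrite (pgroupS _ pG) // (subset_trans MZ) ?center_sub.
have class2 : (nil_class G = 2) <-> G^`(1) \subset 'Z(G).
  rewrite -nil_class2; split=> [-> // | le2].
  by apply/eqP; rewrite eqn_leq le2 ltnNge nil_class1.
have abQ : G^`(1) \subset 'Z(G) -> abelian (G / 'Z(G)).
  exact: sub_der1_abelian.
split=> [AutInn | [/class2 derZ derM cycM]]; last first.
  apply/esym/eqP; rewrite eqEcard Inn_sub_AutZM derM card_Inn /=.
  rewrite (card_AutZM_cyclic _ p) ?abQ //.
  apply: dvdn_trans (exponent_dvdn M).
  exact: exponent_quotient_center_dvd.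
have derM : G^`(1) \subset M by rewrite -Inn_sub_AutZM AutInn.
have derZ := subset_trans derM MZ.
split=> //; first exact/class2.
have [c cM expM] := exponent_witness (abelian_nil abM).
have sCM : <[c]> \subset M by rewrite cycle_subG.
have AutC : AutZM G <[c]> = AutZM G M.
  apply/eqP; rewrite eqEcard AutZMS //= AutInn card_Inn.
  rewrite (card_AutZM_cyclic _ p) ?cycle_cyclic ?abQ ?(pgroupS sCM pM) //.
    exact: subset_trans sCM MZ.
  by rewrite -[#|_|]/(#[c]) -expM exponent_quotient_center_dvd.
apply: (cyclic_if_order_p_sub_cyclic _ p M <[c]>) => // [|u uM ord_u].
  exact: cycle_cyclic.
have [a] := AutZM_reaches_order_p _ p G M u p_pr pG nabG MZ uM ord_u.
by rewrite -AutC => /AutZMP[_ aC _] [x /aC xC <-].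
Qed.
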